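(* Let $v\in\{0,1\}^n$ ($n\ge1$) be a binary vector with $m(v)\ge 1$, and let $X(v)=P(v)\,a(v)$ and $Y(v)=P(v)\,b(v)$. Then the Collatz sequence of first term $X(v)$ and length $n$ has $v$ as its parity vector, i.e. $v_n(X(v))=v$, and $$T^{n}(X(v))=\frac{3^{m(v)}}{2^{n}}X(v)+\frac{P(v)}{2^{n}}=Y(v).$$
   Context: The Collatz map $T$ on positive integers is $T(N)=N/2$ if $N$ is even and $T(N)=(3N+1)/2$ if $N$ is odd. For an integer $N$ let $\mathbf{i}(N)=0$ if $N$ is even and $1$ if $N$ is odd, and for a positive integer $N$ put $v_n(N)=(\mathbf{i}(N),\mathbf{i}(T(N)),\ldots,\mathbf{i}(T^{n-1}(N)))$. For $v=(e_1,\ldots,e_n)\in\{0,1\}^n$, let $m(v)=\sum_{i=1}^n e_i$, let $j_1<\cdots<j_{m}$ ($m=m(v)$) be the positions $i$ with $e_i=1$, and put $P(v)=\sum_{k=1}^{m}3^{m-k}2^{j_k-1}$. For $m\ge1$, sequences $(a_{m,n})_{n\ge1}$ and $(b_{m,n})_{n\ge1}$ are defined by $a_{m,1}=1$, $b_{m,1}=\frac{3^m+1}{2}$, and for $n\ge2$: if $b_{m,n-1}$ is even, $a_{m,n}=a_{m,n-1}$ and $b_{m,n}=\frac{b_{m,n-1}}{2}$; if $b_{m,n-1}$ is odd, $a_{m,n}=a_{m,n-1}+2^{n-1}$ and $b_{m,n}=\frac{b_{m,n-1}+3^m}{2}$. They are positive integers satisfying $3^m a_{m,n}+1=2^n b_{m,n}$.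 For $v$ of length $n$ with $m(v)=m\ge1$, put $a(v)=a_{m,n}$ and $b(v)=b_{m,n}$. *)

(* Defs.v *)
From mathcomp Require Import all_boot.

Set Implicit Arguments.
Unset Strict Implicit.
Unset Printing Implicit Defensive.

(* Only positive integers are meant; T 0 = 0 is a dummy value, harmless since
   T maps positive integers to positive integers. *)
Definition collatz (N : nat) : nat :=
  if odd N then (3 * N + 1) %/ 2 else N %/ 2.

Definition parity_vector (n N : nat) : n.-tuple bool :=
  [tuple odd (iter i collatz N) | i < n].

Definition weight (n : nat) (v : n.-tuple bool) : nat := \sum_(i < n) tnth v i.

(* The increasing sequence j_1 < ... < j_m of the 1-based positions of the
   entries 1 of v. *)
Definition one_positions (n : nat) (v : n.-tuple bool) : seq nat :=
  [seq i <- iota 1 n | nth false v i.-1].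

(* j_k is the item of index k.-1 of one_positions v. *)
Definition Pval (n : nat) (v : n.-tuple bool) : nat :=
  \sum_(1 <= k < (weight v).+1)
    3 ^ (weight v - k) * 2 ^ (nth 0 (one_positions v) k.-1 - 1).

(* The pair (a_{m,n}, b_{m,n}) for n >= 1; the value at n = 0 is a dummy. *)
Fixpoint ab (m n : nat) : nat * nat :=
  match n with
  | 0 => (0, 0)
  | 1 => (1, (3 ^ m + 1) %/ 2)
  | n'.+1 =>
      let: (a, b) := ab m n' in
      if odd b then (a + 2 ^ n', (b + 3 ^ m) %/ 2) else (a, b %/ 2)
  end.

Definition aval (n : nat) (v : n.-tuple bool) : nat := (ab (weight v) n).1.
Definition bval (n : nat) (v : n.-tuple bool) : nat := (ab (weight v) n).2.

Definition Xval (n : nat) (v : n.-tuple bool) : nat := Pval v * aval v.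
Definition Yval (n : nat) (v : n.-tuple bool) : nat := Pval v * bval v.

(* Main.v *)
Require Import Defs.
From mathcomp Require Import all_boot all_order all_algebra.
From mathcomp Require Import zify.
Import Order.TTheory GRing.Theory Num.Theory.

(** Following a parity pattern s of length n with m ones, n Collatz steps act
    as the affine map X |-> (3^m X + P(s)) / 2^n.  The point is that this
    formula also detects the pattern: as soon as 3^m X + P(s) is divisible by
    2^n, the parities of the first n iterates of X must be those of s
    ([collatz_affine]).  Reading s from the left, P(e :: s) = e 3^(m(s)) + 2 P(s)
    ([affine_const], identified with the closed sum in [Pval_affine_const]), so
    divisibility by 2 forces the parity of X to be e, and after one Collatz
    step the same divisibility, with one factor 2 less, holds for s.

    It remains to see that X = P(v) a(v) satisfies the divisibility.  This comes
    from 3^m a + 1 = 2^n b ([ab_bezout]): multiplying by P(v) gives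
    3^m X(v) + P(v) = 2^n Y(v), which also identifies the quotient, that is, the
    n-th iterate, as Y(v). *)

Local Open Scope nat_scope.

(** P(v), computed from the head of the vector; this is the recursion along
    which the Collatz dynamics unfolds. *)
Fixpoint affine_const (s : seq bool) : nat :=
  if s is e :: s' then e * 3 ^ count id s' + 2 * affine_const s' else 0.

(** Positions are counted from 0 here, so that the power of 2 attached to a
    position needs no truncated subtraction. *)
Definition ones (s : seq bool) : seq nat :=
  [seq i <- iota 0 (size s) | nth false s i].

Lemma ones_cons (e : bool) (s : seq bool) :
  ones (e :: s) = nseq e 0 ++ [seq i.+1 | i <- ones s].
Proof.
rewrite /ones /= (iotaDl 1 0) filter_map /=.
by case: e.
Qed.

Lemma size_ones (s : seq bool) : size (ones s) = count id s.
Proof.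
by elim: s => //= e s IHs; rewrite ones_cons size_cat size_nseq size_map IHs.
Qed.

Lemma sum_ones (s : seq bool) :
  \sum_(k < count id s) 3 ^ (count id s - k.+1) * 2 ^ nth 0 (ones s) k
  = affine_const s.
Proof.
elim: s => [|e s IHs] /=; first by rewrite big_ord0.
(* Positions in the tail move up by one, which doubles each of their terms. *)
have shift : \sum_(k < count id s)
    3 ^ (count id s - k.+1) * 2 ^ nth 0 [seq i.+1 | i <- ones s] k
    = 2 * affine_const s.
  rewrite -IHs big_distrr /=; apply: eq_bigr => k _.
  by rewrite (nth_map 0) ?size_ones // expnS mulnCA.
rewrite ones_cons; case: e => /=; last by rewrite shift.
by rewrite add1n big_ord_recl /= subSS subn0 muln1 mul1n -shift.
Qed.

Lemma weight_count (n : nat) (v : n.-tuple bool) : weight v = count id v.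
Proof. by rewrite /weight -sumn_count sumnE big_map big_tuple. Qed.

Lemma Pval_affine_const (n : nat) (v : n.-tuple bool) :
  Pval v = affine_const v.
Proof.
have posE : one_positions v = [seq i.+1 | i <- ones v].
  by rewrite /one_positions /ones size_tuple (iotaDl 1 0) filter_map.
rewrite /Pval posE weight_count -sum_ones big_add1 /= big_mkord.
by apply: eq_bigr => k _; rewrite (nth_map 0) ?size_ones // subSS subn0.
Qed.

(** By induction on s: for a head bit e, powers of 3 being odd, the equation
    modulo 2 says that X has parity e; dividing it by 2 then gives the same
    equation for the tail of s and the next iterate of X. *)
Lemma collatz_affine (s : seq bool) (X Y : nat) :
    3 ^ count id s * X + affine_const s = 2 ^ size s * Y ->
  [seq odd (iter i collatz X) | i <- iota 0 (size s)] = s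
  /\ iter (size s) collatz X = Y.
Proof.
elim: s X => [|e s IHs] X /=; first by rewrite mul1n addn0 mul1n => ->.
move=> eqXY.
have parX : odd X = e.
  move: (congr1 odd eqXY); rewrite expnS !(oddD, oddM, oddX, oddb) /= !orbT /=.
  by case: (odd X); case: (e).
have step : 3 ^ count id s * collatz X + affine_const s = 2 ^ size s * Y.
  have doubleT : 2 * collatz X = 3 ^ e * X + e.
    by rewrite /collatz parX; case: (e) parX => /=; lia.
  apply/eqP; rewrite -(eqn_pmul2l (isT : 0 < 2)); apply/eqP.
  rewrite mulnDr mulnCA doubleT mulnA -expnS -eqXY expnD; lia.
have [parS iterS_Y] := IHs _ step.
rewrite -/(iter _ _ _) -iterS iterSr; split=> //.
rewrite parX (iotaDl 1 0) -map_comp; congr (_ :: _); rewrite -[RHS]parS.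
by apply: eq_map => i /=; rewrite -iterS iterSr.
Qed.

(** The recursion defining (a, b) is the lifting of the inverse of -3^m from
    modulus 2^(n-1) to modulus 2^n: adding 2^(n-1) to a adds the odd number 3^m
    to b, which is done exactly when b is odd, so that b can be halved. *)
Lemma ab_bezout (m n : nat) :
  0 < n -> 3 ^ m * (ab m n).1 + 1 = 2 ^ n * (ab m n).2.
Proof.
case: n => // n _; have odd3m : odd (3 ^ m) by rewrite oddX orbT.
elim: n => [|n IHn]; first by rewrite /=; lia.
rewrite [ab m n.+2]/=; rewrite -/(ab m n.+1); move: IHn.
case: (ab m n.+1) => a b /= IHn.
rewrite (expnS 2 n.+1) -mulnA mulnCA; case: ifP => odd_b /=.
  have -> : 2 * ((b + 3 ^ m) %/ 2) = b + 3 ^ m by lia.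
  by rewrite !mulnDr addnAC IHn (mulnC (3 ^ m)).
by have -> : 2 * (b %/ 2) = b by lia.
Qed.

Lemma XY_affine (n : nat) (v : n.-tuple bool) :
  0 < n -> 3 ^ weight v * Xval v + Pval v = 2 ^ n * Yval v.
Proof.
move=> n_gt0; rewrite /Xval /Yval /aval /bval.
by rewrite [RHS]mulnCA -ab_bezout // mulnDr muln1 mulnCA.
Qed.

Local Open Scope ring_scope.

Theorem theorem4p6 (n : nat) (v : n.-tuple bool)
    (hn : (1 <= n)%N) (hm : (1 <= weight v)%N) :
  [/\ parity_vector n (Xval v) = v,
      (iter n collatz (Xval v))%:R
        = 3%:R ^+ weight v / 2%:R ^+ n * (Xval v)%:R
          + (Pval v)%:R / 2%:R ^+ n :> rat
    & 3%:R ^+ weight v / 2%:R ^+ n * (Xval v)%:R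
        + (Pval v)%:R / 2%:R ^+ n
        = (Yval v)%:R :> rat].
Proof.
have affXY := @XY_affine n v hn.
have [] := @collatz_affine v (Xval v) (Yval v).
  by rewrite -weight_count -Pval_affine_const size_tuple.
rewrite size_tuple => parX iterX.
have quotY : 3%:R ^+ weight v / 2%:R ^+ n * (Xval v)%:R
    + (Pval v)%:R / 2%:R ^+ n = (Yval v)%:R :> rat.
  have pow2_neq0 : 2%:R ^+ n != 0 :> rat by rewrite expf_neq0.
  apply: (mulfI pow2_neq0).
  have -> : 2%:R ^+ n * (Yval v)%:R
      = 3%:R ^+ weight v * (Xval v)%:R + (Pval v)%:R :> rat.
    by rewrite -!natrX -!natrM -natrD affXY.
  by rewrite mulrDr mulrA !(mulrC (2%:R ^+ n)) !divfK.
split=> //; last by rewrite quotY iterX.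
apply: val_inj; rewrite -[RHS]parX /= -val_enum_ord -map_comp.
exact: eq_map.
Qed.
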